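(* Let $(X,\tau,\mathbf{S})$ be a Hausdorff locally convex topological vector space whose topology $\tau$ is generated by the family of seminorms $\mathbf{S}$. Let $Y\subseteq X$ be a compact set and $S:Y\rightrightarrows Y$ be a set-valued map. If $S$ is lower semicontinuous on an infinite $S$-orbit $M:=\{x_i\}_{i=1}^\infty$ such that $$\lim_{i\to\infty}s(x_i-y)=0\quad\text{for all } s\in\mathbf{S}\text{ and for all }y\in S(x_i),$$ meaning that for every $s\in\mathbf{S}$ and every $\varepsilon>0$ there is $N\in\mathbb{N}$ with $s(x_i-y)<\varepsilon$ for all $i\ge N$ and all $y\in S(x_i)$, then there exists a point $\bar{x}\in Y$ such that $S(\bar{x})\subseteq\{\bar{x}\}$.
   Context: $X$ is a vector space and $\mathbf{S}$ is a family of seminorms on $X$ that separates points (for each $x\in X\setminus\{0\}$ there is $s\in\mathbf{S}$ with $s(x)>0$); $\tau$ is the locally convex topology generated by $\mathbf{S}$. $Y$ carries the subspace topology. A set-valued map $S:Y\rightrightarrows Y$ assigns to each $x\in Y$ a (possibly empty) subset $S(x)\subseteq Y$; $\operatorname{dom} S:=\{x\in Y:S(x)\neq\emptyset\}$. An infinite $S$-orbit is a sequence $\{x_i\}_{i=1}^\infty$ in $Y$ with $x_{i+1}\in S(x_i)$ for all $i\ge1$. Writing $M$ also for the set of points of the orbit and $\operatorname{cl}M$ for its closure in $Y$, $S$ is lower semicontinuous on $M$ if for every $x\in\operatorname{cl}M\cap\operatorname{dom}S$ and every open $V\subseteq Y$ with $S(x)\cap V\ne\emptyset$ there is an open neighborhood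 $U\subseteq Y$ of $x$ such that $S(x')\cap V\ne\emptyset$ for all $x'\in U\cap M$. *)

(* Defs.v *)
From HB Require Import structures.
From mathcomp Require Import all_boot all_order all_algebra.
From mathcomp Require Import all_classical all_reals all_analysis.

Set Implicit Arguments.
Unset Strict Implicit.
Unset Printing Implicit Defensive.

Import Order.TTheory GRing.Theory Num.Theory.
Import numFieldNormedType.Exports.

Local Open Scope classical_set_scope.
Local Open Scope ring_scope.

(* The scalars form a numFieldType so that real and complex spaces are both
   covered; as for the norms of the library, a seminorm takes its values in K,
   and [0 <= s x] makes them real. *)
Definition seminorm (K : numFieldType) (X : lmodType K) (s : X -> K) : Prop :=
  [/\ forall x, 0 <= s x,
      forall x y, s (x + y) <= s x + s y
    & forall (a : K) x, s (a *: x) = `|a| * s x].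

Definition separates_points (K : numFieldType) (X : lmodType K)
    (SS : set (X -> K)) : Prop :=
  forall x : X, x != 0 -> exists2 s, SS s & 0 < s x.

(* The finite intersections of balls of common radius e of members of SS form
   a neighbourhood base at every point. *)
Definition generated_by_seminorms (K : numFieldType) (X : tvsType K)
    (SS : set (X -> K)) : Prop :=
  forall (x : X) (A : set X), nbhs x A <->
    exists (F : set (X -> K)) (e : K),
      [/\ finite_set F, F `<=` SS, 0 < e &
          \bigcap_(s in F) [set y | s (y - x) < e] `<=` A].

Definition set_valued_dom (T : Type) (S : T -> set T) : set T :=
  [set x | S x !=set0].

(* The orbit is indexed from 0, so [x i] is the term of index i + 1. *)
Definition infinite_orbit (T : Type) (S : T -> set T) (x : nat -> T) : Prop :=
  forall i, S (x i) (x i.+1).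

Definition lower_semicontinuous_on (T : topologicalType) (S : T -> set T)
    (M : set T) : Prop :=
  forall x, (closure M `&` set_valued_dom S) x ->
  forall V : set T, open V -> S x `&` V !=set0 ->
  exists U : set T, [/\ open U, U x &
    forall x', (U `&` M) x' -> S x' `&` V !=set0].

(* Main.v *)
(* A cluster point p of the orbit works: if S p contained y with
   s (y - p) > 0, then lower semicontinuity would provide, for some late x_i
   that is s-close to p, a point z of S x_i that is s-close to y; as z is also
   s-close to x_i, the triangle inequality gives a contradiction. *)
Require Import Defs.
From HB Require Import structures.
From mathcomp Require Import all_boot all_order all_algebra.
From mathcomp Require Import all_classical all_reals all_analysis.
From mathcomp Require Import ring.

Set Implicit Arguments.
Unset Strict Implicit.
Unset Printing Implicit Defensive.

Import Order.TTheory GRing.Theory Num.Theory.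
Import numFieldNormedType.Exports.

Local Open Scope classical_set_scope.
Local Open Scope ring_scope.

Lemma seminorm_distrC (K : numFieldType) (X : lmodType K) (s : X -> K) x y :
  seminorm s -> s (x - y) = s (y - x).
Proof. by case=> _ _ sZ; rewrite -(opprB y x) -(scaleN1r (y - x)) sZ normrN1 mul1r. Qed.

Lemma ltr_split3 (K : numFieldType) (e a b c : K) :
  a < e / 3 -> b < e / 3 -> c < e / 3 -> a + b + c < e.
Proof.
move=> ae be ce; have -> : e = e / 3 + e / 3 + e / 3 by field.
by rewrite !ltrD.
Qed.

Lemma nbhs_seminorm_ball (K : numFieldType) (X : tvsType K) (SS : set (X -> K))
    (s : X -> K) (x : X) (e : K) :
  generated_by_seminorms SS -> SS s -> 0 < e ->
  nbhs x [set y | s (y - x) < e].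
Proof.
move=> gen SSs e0; apply/gen; exists [set s], e; split => //.
  by move=> _ ->.
by move=> y /(_ s); exact.
Qed.

(** Compactness of [Y] concerns filters on [T], so the sequence is pushed into [T] along [set_val];
    a cluster point of the image of [\oo] is then lifted back to [Y]. *)
Lemma compact_seq_cluster (T : topologicalType) (Y : set T) (x : nat -> Y) :
  compact Y -> exists p : Y, forall B, nbhs p B ->
  forall N, exists2 i, (N <= i)%N & B (x i).
Proof.
move=> /(_ ((fun i => set_val (x i)) @ \oo)) [].
  by exists 0 => // i _; exact: set_valP.
move=> p [Yp clp]; exists (SigSub (mem_set Yp)) => B.
(* A neighbourhood in [Y] contains the trace of an open [C] of [T]; [C] meets the tail of the
   sequence from [N] on. *)
case=> _ [/= [C oC <-] Cp CB] N.
have [||_ [[i Ni <-] Ci]] :=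
    clp [set set_val (x i) | i in [set i | (N <= i)%N]] C.
- by exists N => // i Ni; exists i.
- exact: open_nbhs_nbhs.
- by exists i => //; exact: CB.
Qed.

Theorem corollary3p2 (K : numFieldType) (X : tvsType K) (SS : set (X -> K))
    (SS_seminorm : forall s, SS s -> seminorm s)
    (SS_separates : separates_points SS)
    (SS_generates : generated_by_seminorms SS)
    (X_hausdorff : hausdorff_space X)
    (Y : set X) (Y_compact : compact Y)
    (S : Y -> set Y) (x : nat -> Y)
    (x_orbit : infinite_orbit S x)
    (S_lsc : lower_semicontinuous_on S (range x))
    (S_lim : forall s, SS s -> forall e : K, 0 < e ->
      exists N : nat, forall i : nat, (N <= i)%N ->
      forall y : Y, S (x i) y -> s (\val (x i) - \val y) < e) :
  exists xbar : Y, S xbar `<=` [set xbar].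
Proof.
have [p xp] := compact_seq_cluster x Y_compact.
exists p => y Spy; apply: contrapT => yp.
have yBp0 : \val y - \val p != 0.
  by rewrite subr_eq0; apply/eqP => /val_inj.
have [s SSs d0] := SS_separates _ yBp0.
have seminorm_s := SS_seminorm _ SSs.
have sD := let: And3 _ sD _ := seminorm_s in sD.
set d := s (\val y - \val p) in d0.
have d30 : 0 < d / 3 by rewrite divr_gt0.
(* The topology of [Y] is initial for [set_val], so balls of the ambient space pull back to
   neighbourhoods. *)
have ball_nbhs (q : Y) : nbhs q [set z : Y | s (\val z - \val q) < d / 3].
  exact: (@initial_continuous _ _ (set_val : Y -> X) q) _
    (nbhs_seminorm_ball (\val q) SS_generates SSs d30).
have clp : closure (range x) p.
  by move=> B /xp /(_ 0) [i _ Bi]; exists (x i); split => //; exists i.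
(* Lower semicontinuity asks for an open set, hence the interior of the ball around [y]. *)
have [||U [oU Up SU]] := S_lsc p _ _ (open_interior
    [set z : Y | s (\val z - \val y) < d / 3]).
- by split => //; exists y.
- by exists y; split => //; exact: ball_nbhs.
have [N S_close] := S_lim _ SSs _ d30.
(* A single index has to serve three ends: [i] is at least [N], and [x i] lies both in [U] and in
   the ball around [p]. *)
have [i Ni [Ui xip]] := xp _ (filterI (open_nbhs_nbhs (conj oU Up))
  (ball_nbhs p)) N.
have [|z [Sz /interior_subset /= zy]] := SU (x i); first by split => //; exists i.
have := S_close i Ni z Sz.
rewrite seminorm_distrC // in zy; rewrite seminorm_distrC // => zxi.
(* The path from [y] to [p] through [z] and [x i] has three legs, each shorter than [d / 3]. *)
have : d < d; last by rewrite ltxx.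
apply: le_lt_trans (ltr_split3 zy zxi xip).
apply: (le_trans (y := s (\val y - \val (x i)) + s (\val (x i) - \val p))).
  by rewrite /d -(subrKA (\val (x i))) sD.
by rewrite lerD2r -(subrKA (\val z)) sD.
Qed.
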